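(* For all $n,s\in\mathbb{N}$, $$\operatorname{rk}(q_n^s)\leq 2^{s-1}\binom{n}{s}+2^{s-2}\binom{n}{s-1}+\sum_{k=1}^{s-2}2^{k-1}\,k!\,\mathrm{p}_k(s)\binom{n}{k}.$$ In particular, for any fixed $s\in\mathbb{N}$, the rank of $q_n^s$ grows at most as $n^s$, i.e. $\operatorname{rk}(q_n^s)=O(n^s)$ as $n\to+\infty$.
   Context: Here $n,s$ are positive integers and $q_n=x_1^2+\cdots+x_n^2\in\mathbb{C}[x_1,\dots,x_n]$. For a homogeneous polynomial $f\in\mathbb{C}[x_1,\dots,x_n]$ of degree $d$, the (Waring) rank $\operatorname{rk} f$ is the smallest natural number $r$ such that $f=\sum_{j=1}^r l_j^d$ for some linear forms $l_1,\dots,l_r\in\mathbb{C}[x_1,\dots,x_n]$. For $k\in\mathbb{N}$, $\mathrm{p}_k(s)$ denotes the number of partitions of $s$ into exactly $k$ positive parts, i.e. the number of $k$-tuples $(m_1,\dots,m_k)$ of integers with $m_1\ge\cdots\ge m_k>0$ and $m_1+\cdots+m_k=s$. Binomial coefficients $\binom{n}{k}$ with $k>n$ are $0$, and an empty sum is $0$. *)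

(* Defs.v *)
From HB Require Import structures.
From mathcomp Require Import all_boot all_order all_algebra.
From mathcomp Require Import boolp.
From mathcomp Require Import mpoly.

Set Implicit Arguments.
Unset Strict Implicit.
Unset Printing Implicit Defensive.

Import Order.TTheory GRing.Theory Num.Theory.
Local Open Scope ring_scope.

Section Waring.
Variables (K : comNzRingType) (n : nat).
Implicit Types (d r : nat) (f l : {mpoly K[n]}).

Definition waring_decomposable d f r : Prop :=
  exists l : 'I_r -> {mpoly K[n]},
    (forall j, l j \is 1.-homog) /\ f = \sum_(j < r) l j ^+ d.

(* The rank of f as a form of degree d. The value 0 of the second branch is
   never used when 0 < d and f is d-homogeneous over an algebraically closed
   field of characteristic 0, see waring_rankP. *)
Definition waring_rank d f : nat :=
  if pselect (exists r, `[< waring_decomposable d f r >]) is left ex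
  then ex_minn ex else 0%N.

Definition quadric : {mpoly K[n]} := \sum_(i < n) 'X_i ^+ 2.

End Waring.

Arguments quadric K n : clear implicits.

Definition npartitions (k s : nat) : nat :=
  #|[set m : k.-tuple 'I_s.+1 |
      [&& sorted geq (map val m), [forall i, (0 < tnth m i)%N]
        & (\sum_(i < k) tnth m i == s)%N]]|.

Section WaringRankP.
Variables (K : numClosedFieldType) (n : nat).
Implicit Types (a b d r : nat) (f g l m : {mpoly K[n]}).

Let wdec d f : Prop := exists r, waring_decomposable d f r.

Let wdec0 d : wdec d 0.
Proof. by exists 0%N, (fun=> 0); split=> [j|]; rewrite ?dhomog0 ?big_ord0. Qed.

Let wdecD d f g : wdec d f -> wdec d g -> wdec d (f + g).
Proof.
move=> [r [l [hl ->]]] [r' [l' [hl' ->]]]; exists (r + r')%N.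
exists (fun j => match split j with inl i => l i | inr i => l' i end).
split=> [j|]; first by case: (split j).
rewrite big_split_ord /=; congr (_ + _); apply: eq_bigr => i _.
  by rewrite (unsplitK (inl _ i)).
by rewrite (unsplitK (inr _ i)).
Qed.

Let wdec_sum d (I : Type) (s : seq I) (F : I -> {mpoly K[n]}) :
  (forall i, wdec d (F i)) -> wdec d (\sum_(i <- s) F i).
Proof. by move=> hF; apply: big_ind => // *; exact: wdecD. Qed.

Let wdecX d l : l \is 1.-homog -> wdec d (l ^+ d).
Proof. by move=> hl; exists 1%N, (fun=> l); rewrite big_ord1. Qed.

Let wdecZ d c f : (0 < d)%N -> wdec d f -> wdec d (c *: f).
Proof.
move=> d0 [r [l [hl ->]]]; exists r, (fun j => d.-root c *: l j).
split=> [j|]; first exact: dhomogZ.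
by rewrite scaler_sumr; apply: eq_bigr => j _; rewrite exprZn rootCK.
Qed.

Let vdm_coef d b : (b <= d)%N -> exists c : 'I_d.+1 -> K,
  forall k, (k <= d)%N -> \sum_i c i * i%:R ^+ k = (k == b)%:R.
Proof.
move=> bd; pose V := Vandermonde d.+1 (\row_(j < d.+1) j%:R : 'rV[K]_d.+1).
have uV : V \in unitmx.
  rewrite unitmxE det_Vandermonde unitfE; apply/prodf_neq0 => i _.
  apply/prodf_neq0 => j ij; rewrite !mxE subr_eq0 eqr_nat.
  by rewrite gtn_eqF.
pose D : 'cV[K]_d.+1 := delta_mx (inord b) 0.
exists (fun i => (invmx V *m D) i 0) => k kd.
have := congr1 (fun M : 'cV[K]_d.+1 => M (inord k) 0) (mulKVmx uV D).
rewrite mxE => e; transitivity (D (inord k) 0).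
  rewrite -e; apply: eq_bigr => i _.
  rewrite [V _ _]mxE [in X in _ = X]mxE inordK //.
  by rewrite mulrC.
by rewrite mxE eqxx andbT -val_eqE /= !inordK.
Qed.

Let wdec_mono2 a b l m : l \is 1.-homog -> m \is 1.-homog ->
  wdec (a + b) (l ^+ a * m ^+ b).
Proof.
move=> hl hm; have [d0|d0] := posnP (a + b)%N.
  move/eqP: (d0); rewrite addn_eq0 => /andP[/eqP-> /eqP->].
  by rewrite mulr1; exact: (@wdecX 0).
set d := (a + b)%N in d0 *; have bd : (b <= d)%N by rewrite leq_addl.
have [c hc] := vdm_coef bd.
suff -> : l ^+ a * m ^+ b =
    'C(d, b)%:R^-1 *: \sum_i c i *: (l + i%:R *: m) ^+ d.
  apply: wdecZ => //; apply: wdec_sum => i; apply: wdecZ => //; apply: wdecX.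
  by apply: dhomogD => //; apply: dhomogZ.
transitivity ('C(d, b)%:R^-1 *: \sum_(k < d.+1)
  (\sum_i c i * i%:R ^+ k) *: ((l ^+ (d - k) * m ^+ k) *+ 'C(d, k))).
  rewrite (bigD1 (inord b)) //= inordK // hc // eqxx scale1r big1 ?addr0.
    rewrite -scaler_nat scalerA mulVf ?scale1r ?addnK //.
    by rewrite pnatr_eq0 -lt0n bin_gt0.
  move=> k; rewrite -val_eqE /= inordK // => kb.
  by rewrite (hc k (ltn_ord k)) (negPf kb) scale0r.
congr (_ *: _); under eq_bigr do rewrite scaler_suml.
rewrite exchange_big; apply: eq_bigr => i _ /=.
rewrite exprDn scaler_sumr; apply: eq_bigr => k _.
by rewrite exprZn -scalerAr -scalerA scalerMnr.
Qed.

Let wdecM a b l g : l \is 1.-homog -> wdec b g -> wdec (a + b) (l ^+ a * g).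
Proof.
move=> hl [r [m [hm ->]]]; rewrite mulr_sumr.
by apply: wdec_sum => j; apply: wdec_mono2.
Qed.

Let wdec_monomial (m : 'X_{1..n}) : wdec (mdeg m) 'X_[m].
Proof.
rewrite mpolyXE_id mdegE.
elim: (index_enum _) => [|i s IHs].
  by rewrite !big_nil; apply: (@wdecX 0 0); rewrite dhomog0.
by rewrite !big_cons; apply: wdecM => //; rewrite dhomogX /= mdeg1.
Qed.

Lemma waring_decomposable_homog d f : (0 < d)%N -> f \is d.-homog ->
  exists r, waring_decomposable d f r.
Proof.
move=> d0 /dhomogP hf; rewrite (mpolyE f) big_seq.
apply: (big_ind (wdec d)); [exact: wdec0|exact: wdecD|move=> m /hf md].
by apply: wdecZ => //; rewrite -md; exact: wdec_monomial.
Qed.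

Lemma waring_rankP d f : (0 < d)%N -> f \is d.-homog ->
  waring_decomposable d f (waring_rank d f) /\
  (forall r, waring_decomposable d f r -> (waring_rank d f <= r)%N).
Proof.
move=> d0 hf; rewrite /waring_rank; case: pselect => [ex|nex].
  by case: ex_minnP => r /asboolP hr min; split=> // r' hr'; apply/min/asboolP.
have [r hr] := waring_decomposable_homog d0 hf.
by case: nex; exists r; apply/asboolP.
Qed.

End WaringRankP.

(* Main.v *)
Require Import Defs.
From mathcomp Require Import all_boot all_order all_algebra perm complex.
From mathcomp Require Import mpoly zify ring boolp.

(** Expanded in monomials, the s-th power of the quadric is a form of degree 2s
that is symmetric, has only even exponents, and whose monomials involve at most
s variables ([even_symmetric]).  The number k of variables that may occur in
one monomial is lowered one step at a time.  By symmetry, the part of such a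
form supported on monomials in exactly k variables is determined by its
coefficients at the monomials with exponents 2 l_1 >= ... >= 2 l_k > 0, where
l runs over the partitions of s into k parts ([even_symmetric_support_pred]).

These coefficients are matched by power sums of the same shape.  For a vector
a with k possibly nonzero entries, add up the 2s-th powers of all linear forms
whose coefficient vectors arise from a by permuting entries and changing signs
([orbsum]).  The sign changes cancel the odd exponents, so the sum is again
even and symmetric, with at most k variables in each monomial.  Up to a global
sign, which an even power does not see, there are at most 2^(k-1) k! C(n,k)
such forms ([waring_orbsum]), and only 2^(k-1) C(n,k) when the nonzero entries
of a are all equal to 1 ([waring_orbsum_ones]).

Let p_k(s) be the number of partitions of s into k parts.  There are p_k(s)
vectors a for which the matrix of the coefficients of the orbit sums at the
partition monomials is invertible ([generic_points]): the points of the curve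
a_i = t^(B^i), with B larger than all exponents, turn distinct partitions into
univariate polynomials in t that are linearly independent, because an exponent
can be read off from its digits in base B.  Hence the monomials in exactly k
variables can be removed with 2^(k-1) k! p_k(s) C(n,k) powers
([even_symmetric_reduce]).  For k = s and k = s - 1 there is at most one
partition, and the all-ones vector alone is enough
([even_symmetric_reduce_near_top]).  When no variable is left, the remaining
form of positive degree is zero.  Adding up the costs gives the bound, and the
growth rate follows from C(n,k) <= n^k. *)

Set Implicit Arguments.
Unset Strict Implicit.
Unset Printing Implicit Defensive.

Import Order.TTheory GRing.Theory Num.Theory.
Local Open Scope ring_scope.

(** * Calculus of sums of powers of linear forms *)

Section WaringCalculus.
Variables (K : numClosedFieldType) (n d : nat).
Hypothesis d_gt0 : (0 < d)%N.
Implicit Types (r : nat) (f g l : {mpoly K[n]}).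

Local Notation wdec := (@waring_decomposable K n d).

Lemma waring_rank_le f r : wdec f r -> (waring_rank d f <= r)%N.
Proof.
move=> fr; rewrite /waring_rank; case: pselect => [ex|//].
by case: ex_minnP => r0 _; apply; apply/asboolP.
Qed.

Lemma waring0 r : wdec 0 r.
Proof.
exists (fun=> 0); split=> [j|]; first exact: dhomog0.
by rewrite big1 // => j _; rewrite expr0n eqn0Ngt d_gt0.
Qed.

Lemma waringD f g r r' : wdec f r -> wdec g r' -> wdec (f + g) (r + r').
Proof.
move=> [l [hl ->]] [l' [hl' ->]].
exists (fun j => match split j with inl i => l i | inr i => l' i end).
split=> [j|]; first by case: (split j).
rewrite big_split_ord /=; congr (_ + _); apply: eq_bigr => i _.
  by rewrite (unsplitK (inl _ i)).
by rewrite (unsplitK (inr _ i)).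
Qed.

Lemma waring_sum (I : finType) (A : pred I) (F : I -> {mpoly K[n]}) r :
  (forall i, A i -> wdec (F i) r) -> wdec (\sum_(i | A i) F i) (#|A| * r).
Proof.
move=> Fr; rewrite -sum_nat_const.
apply: (big_ind2 (fun f r => wdec f r)) => //; first exact: waring0.
by move=> f1 r1 f2 r2; exact: waringD.
Qed.

Lemma waringX l : l \is 1.-homog -> wdec (l ^+ d) 1.
Proof. by move=> hl; exists (fun=> l); rewrite big_ord1. Qed.

Lemma waringZ c f r : wdec f r -> wdec (c *: f) r.
Proof.
move=> [l [hl ->]]; exists (fun j => d.-root c *: l j).
split=> [j|]; first exact: dhomogZ.
by rewrite scaler_sumr; apply: eq_bigr => j _; rewrite exprZn rootCK.
Qed.

(** Summands with the same label merge into one up to a scalar, which has a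
[d]-th root; so the cost counts labels and not summands. *)
Lemma waring_fibers (T U : finType) (A : {set U}) (kappa : T -> U)
    (F : U -> {mpoly K[n]}) r :
    (forall t, kappa t \in A) -> (forall u, u \in A -> wdec (F u) r) ->
  wdec (\sum_t F (kappa t)) (#|A| * r).
Proof.
move=> kA Fr; rewrite (partition_big kappa (mem A)) //=.
apply: waring_sum => u uA; rewrite (eq_bigr (fun=> F u)) => [|t /eqP-> //].
by rewrite sumr_const -scaler_nat; apply/waringZ/Fr.
Qed.

End WaringCalculus.

(** * Coefficients of powers of linear forms *)

Section LinearPowers.
Variables (K : comNzRingType) (n : nat).
Implicit Types (d : nat) (v : 'I_n -> K) (m : 'X_{1..n}).

Definition lform v : {mpoly K[n]} := \sum_i v i *: 'X_i.

Lemma lform_homog v : lform v \is 1.-homog.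
Proof.
by apply: rpred_sum => i _; apply: dhomogZ; rewrite dhomogX /= mdeg1.
Qed.

Lemma mcoeffMXi (f : {mpoly K[n]}) i m :
  (f * 'X_i)@_m = if m i == 0%N then 0 else f@_(m - U_(i))%MM.
Proof.
case: (posnP (m i)) => [mi0|mi]; last first.
  have {1}-> : m = (U_(i) + (m - U_(i)))%MM.
    apply/mnmP => j; rewrite mnmDE mnmBE mnm1E.
    by case: eqVneq => [<-|]; rewrite ?subnKC ?subn0.
  by rewrite mcoeffMX.
rewrite mcoeffM big1 // => -[k1 k2] /= /eqP e.
rewrite mcoeffX; case: eqP; last by rewrite mulr0.
by move=> e2; have := congr1 (fun m' : 'X_{1..n} => m' i) e;
  rewrite mnmDE -e2 mnm1E eqxx mi0 addn1.
Qed.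

(** Rescaling the variables separates the multinomial coefficient, written here
as a coefficient of a power of the sum of all variables, from the contribution
of [v]. *)
Lemma mcoeff_lformX d v m :
  (lform v ^+ d)@_m = (lform (fun=> 1) ^+ d)@_m * \prod_i v i ^+ m i.
Proof.
elim: d m => [|d IHd] m.
  rewrite !expr0 mcoeff1; case: eqP => [->|]; last by rewrite mul0r.
  by rewrite big1 ?mul1r // => i _; rewrite mnm0E.
rewrite !exprSr {2 4}/lform !mulr_sumr !raddf_sum /= mulr_suml.
apply: eq_bigr => i _; rewrite -!scalerAr !mcoeffZ mul1r !mcoeffMXi.
case: (posnP (m i)) => [_|mi]; first by rewrite mulr0 mul0r.
rewrite IHd mulrCA; congr (_ * _); rewrite (bigD1 i) //= [RHS](bigD1 i) //=.
rewrite mulrA mnmBE mnm1E eqxx -exprS subn1 prednK //; congr (_ * _).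
by apply: eq_bigr => j ji; rewrite mnmBE mnm1E eq_sym (negPf ji) subn0.
Qed.

Lemma lform1_sym : lform (fun=> 1) \is symmetric.
Proof.
apply/issymP => s; rewrite /lform raddf_sum /=.
rewrite [RHS](reindex_inj (@perm_inj _ s)) /=.
apply: eq_bigr => i _; rewrite !scale1r msymX; congr 'X_[_].
apply/mnmP => j; rewrite mnmE !mnm1E.
by rewrite -(inj_eq (@perm_inj _ s)) permKV.
Qed.

End LinearPowers.

Section LinearPowersPositive.
Variables (K : numDomainType) (n : nat).
Implicit Types (d : nat) (m : 'X_{1..n}).

Local Notation lform := (@lform K n).

Lemma mcoeff_lform1X_ge0 d m : 0 <= (lform (fun=> 1) ^+ d)@_m.
Proof.
elim: d m => [|d IHd] m; first by rewrite expr0 mcoeff1 ler0n.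
rewrite exprSr {2}/lform mulr_sumr raddf_sum sumr_ge0 // => i _.
by rewrite scale1r /= mcoeffMXi; case: ifP.
Qed.

Lemma mcoeff_lform1X_gt0 m : 0 < (lform (fun=> 1) ^+ mdeg m)@_m.
Proof.
move: {2}(mdeg m) (erefl (mdeg m)) => d; elim: d m => [|d IHd] m md.
  move/eqP: (md); rewrite mdeg_eq0 => /eqP->.
  by rewrite mdeg0 expr0 mcoeff1 eqxx.
have [i mi] : exists i, m i != 0%N.
  apply/existsP; apply: contra_eqT md; rewrite negb_exists => /forallP m0.
  by rewrite mdegE big1 // => i _; apply/eqP; move: (m0 i); rewrite negbK.
have e : m = (U_(i) + (m - U_(i)))%MM.
  apply/mnmP => j; rewrite mnmDE mnmBE mnm1E.
  by case: eqVneq => [<-|]; rewrite ?subnKC ?subn0 ?lt0n.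
rewrite md exprSr {2}/lform mulr_sumr raddf_sum (bigD1 i) //= scale1r.
rewrite mcoeffMXi (negPf mi) ltr_wpDr //.
  apply: sumr_ge0 => j _; rewrite scale1r mcoeffMXi.
  by case: ifP => // _; exact: mcoeff_lform1X_ge0.
have md' : mdeg (m - U_(i))%MM = d.
  by move: md; rewrite e mdegD mdeg1 add1n -e => -[].
by rewrite -{1}md'; apply: IHd.
Qed.

End LinearPowersPositive.

(** * Antitone sequences, digits and partitions *)

Section Combinatorics.

Lemma card_ord_lt n k : (k <= n)%N -> #|[set i : 'I_n | (i < k)%N]| = k.
Proof.
move=> kn; have wk_inj : injective (widen_ord kn).
  by move=> i j /(congr1 val) /= /val_inj.
rewrite -[RHS]card_ord -(card_imset _ wk_inj); apply: eq_card => i.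
apply/idP/imsetP => [|[j _ ->]]; last by rewrite inE /= ltn_ord.
by rewrite inE => ik; exists (Ordinal ik) => //; apply: val_inj.
Qed.

Lemma antitone_support n (g : 'I_n -> nat) :
    (forall i j : 'I_n, (i <= j)%N -> (g j <= g i)%N) ->
  forall i, (g i != 0%N) = (i < #|[set j | g j != 0%N]|)%N.
Proof.
move=> g_anti i; apply/idP/idP => [gi|]; last first.
  apply: contraTneq => gi; rewrite -leqNgt.
  rewrite -[X in (_ <= X)%N](card_ord_lt (ltnW (ltn_ord i))).
  apply/subset_leq_card/subsetP => j; rewrite !inE; apply: contraR.
  by rewrite -leqNgt => /g_anti; rewrite gi leqn0.
rewrite -[X in (X <= _)%N](card_ord_lt (ltn_ord i)).
apply/subset_leq_card/subsetP => j; rewrite !inE ltnS => /g_anti.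
by apply: contraTneq => ->; rewrite -ltnNge lt0n.
Qed.

Lemma antitone_perm_eq n (g h : 'I_n -> nat) (p : 'S_n) :
    (forall i j : 'I_n, (i <= j)%N -> (g j <= g i)%N) ->
    (forall i j : 'I_n, (i <= j)%N -> (h j <= h i)%N) ->
  (forall i, g i = h (p i)) -> g =1 h.
Proof.
move=> g_anti h_anti gh.
have anti_sorted (f : 'I_n -> nat) :
    (forall i j : 'I_n, (i <= j)%N -> (f j <= f i)%N) ->
  sorted geq [tuple f i | i < n].
  move=> f_anti; apply/(sortedP 0%N) => i; rewrite size_tuple => i1.
  have i0 := ltnW i1; rewrite -(tnth_nth _ _ (Ordinal i0)).
  by rewrite -(tnth_nth _ _ (Ordinal i1)) !tnth_mktuple; apply: f_anti => /=.
suff e : [tuple g i | i < n] = [tuple h i | i < n].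
  by move=> i; move: (congr1 (fun t => tnth t i) e); rewrite !tnth_mktuple.
apply: val_inj; apply: (@sorted_eq _ geq).
- by move=> y x z xy yz; exact: leq_trans yz xy.
- by move=> x y /andP[xy yx]; apply: anti_leq; apply/andP.
- exact: anti_sorted.
- exact: anti_sorted.
apply/tuple_permP; exists p; congr val; apply: eq_from_tnth => i.
by rewrite !tnth_mktuple.
Qed.

Lemma digits_inj B n (c c' : 'I_n -> nat) :
    (forall i, (c i < B)%N) -> (forall i, (c' i < B)%N) ->
  (\sum_i c i * B ^ i = \sum_i c' i * B ^ i)%N -> c =1 c'.
Proof.
elim: n c c' => [|n IHn] c c' cB c'B; first by move=> _ [].
have split (e : 'I_n.+1 -> nat) : (\sum_i e i * B ^ i =
    (\sum_(i < n) e (lift ord0 i) * B ^ i) * B + e ord0)%N.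
  rewrite big_ord_recl expn0 muln1 addnC big_distrl /=; congr (_ + _)%N.
  by apply: eq_bigr => i _; rewrite -mulnA -expnSr.
rewrite !split => e.
have B0 : (0 < B)%N by apply: leq_trans (cB ord0).
have e0 : c ord0 = c' ord0.
  by move: (congr1 (modn^~ B) e); rewrite /= !modnMDl !modn_small.
move/eqP: e; rewrite e0 eqn_add2r eqn_pmul2r // => /eqP /IHn e i.
case: (unliftP ord0 i) => [j|] -> //.
by rewrite e.
Qed.

Definition partitions k s : {set k.-tuple 'I_s.+1} :=
  [set m : k.-tuple 'I_s.+1 |
      [&& sorted geq (map val m), [forall i, (0 < tnth m i)%N]
        & (\sum_(i < k) tnth m i == s)%N]].

Lemma card_partitions k s : #|partitions k s| = npartitions k s.
Proof. by []. Qed.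

Lemma sorted_antitone k s (l : k.-tuple 'I_s.+1) i j :
    sorted geq (map val l) -> (i <= j)%N ->
  (nth 0%N (map val l) j <= nth 0%N (map val l) i)%N.
Proof.
move=> ls ij; case: (ltnP j k) => jk; last first.
  by rewrite nth_default // size_map size_tuple.
have geq_trans : transitive geq by move=> y x z xy yz; exact: leq_trans yz xy.
have geq_refl : reflexive geq by move=> x; exact: leqnn.
apply: (sorted_leq_nth geq_trans geq_refl 0%N ls) => //;
  rewrite inE size_map size_tuple //.
exact: leq_ltn_trans jk.
Qed.

(** A partition of [s] into [k >= s - 1] parts can only be [1, ..., 1] or
[2, 1, ..., 1]. *)
Lemma partitions_near_top k s (l l' : k.-tuple 'I_s.+1) : (s <= k.+1)%N ->
  l \in partitions k s -> l' \in partitions k s -> l = l'.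
Proof.
have main (u : k.-tuple 'I_s.+1) : (s <= k.+1)%N -> u \in partitions k s ->
    forall i : 'I_k,
    tnth u i = (if i == 0%N :> nat then s - k.-1 else 1)%N :> nat.
  move=> sk; rewrite inE => /and3P[us /forallP u0 /eqP usum].
  have u1 (i : 'I_k) : i != 0%N :> nat -> tnth u i = 1%N :> nat.
    move=> i0; have k0 : (0 < k)%N by apply: leq_ltn_trans (ltn_ord i).
    pose o := Ordinal k0.
    have ui : (tnth u i <= tnth u o)%N.
      have := sorted_antitone us (leq0n i).
      rewrite -(tnth_nth _ (map_tuple val u) o).
      by rewrite -(tnth_nth _ (map_tuple val u) i) !tnth_map.
    have io : i != o by rewrite -val_eqE.
    move: usum; rewrite (bigD1 o) //= (bigD1 i) //=.
    have : (\sum_(j < k | (j != o) && (j != i)) 1 <=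
            \sum_(j < k | (j != o) && (j != i)) tnth u j)%N.
      by apply: leq_sum => j _; exact: u0.
    rewrite sum1_card; set c := #|_|; have : (c + 2 = k)%N.
      have -> : c = #|predC (pred2 o i)|.
        by apply: eq_card => j; rewrite !inE negb_or.
      by have := cardC (pred2 o i); rewrite card2 eq_sym io card_ord addnC.
    move: (u0 i) ui.
    move: (\sum_(_ < _ | _) _)%N (val (tnth u i)) (val (tnth u o)) => S x y.
    by clearbody c; lia.
  move=> i; case: eqP => [i0|/eqP]; last exact: u1.
  have : (\sum_(j < k) tnth u j = tnth u i + k.-1)%N.
    rewrite (bigD1 i) //=; congr (_ + _)%N.
    rewrite (eq_bigr (fun=> 1%N)) => [|j ji]; last first.
      by apply: u1; rewrite -i0 val_eqE.
    by rewrite sum1_card cardC1 card_ord.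
  by rewrite usum => e; rewrite [in RHS]e addnK.
move=> sk hl hl'; apply: eq_from_tnth => i; apply: val_inj.
by rewrite /= !main.
Qed.

End Combinatorics.

(** * Power sums over hyperoctahedral orbits *)

Section OrbitSums.
Variables (K : numClosedFieldType) (n s : nat).
Hypothesis s_gt0 : (0 < s)%N.
Implicit Types (v a : 'I_n -> K) (m : 'X_{1..n}) (k : nat).

Let d_gt0 : (0 < 2 * s)%N. Proof. by rewrite muln_gt0. Qed.

Definition flip (E : {set 'I_n}) v := fun i => (-1) ^+ (i \in E) * v i.

Definition signsum v := \sum_(E : {set 'I_n}) lform (flip E v) ^+ (2 * s).

(** The sum runs over group elements and not over the orbit itself, so each form
is counted with the same multiplicity; [waring_fibers] later discards it. *)
Definition orbsum a := \sum_(p : 'S_n) signsum (a \o p).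

Lemma lformN v : lform (fun i => - v i) = - lform v.
Proof. by rewrite /lform -sumrN; apply: eq_bigr => i _; rewrite scaleNr. Qed.

(** Only the signs on [S] matter, and an even power does not see a simultaneous
change of all of them, so the sign at one chosen point of [S] can be made
positive. *)
Lemma waring_signsum v (S : {set 'I_n}) :
    (0 < #|S|)%N -> (forall i, i \notin S -> v i = 0) ->
  waring_decomposable (2 * s) (signsum v) (2 ^ #|S|.-1).
Proof.
move=> /card_gt0P[x xS] vS.
(* The representative of a sign pattern with a positive sign at x. *)
pose rep (E : {set 'I_n}) := if x \in E then S :\: E else S :&: E.
have repE E : lform (flip E v) ^+ (2 * s) = lform (flip (rep E) v) ^+ (2 * s).
  rewrite /rep; case: ifP => xE; last first.
    congr (lform _ ^+ _); apply: funext => i; rewrite /flip !inE.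
    by case: (boolP (i \in S)) => // /vS->; rewrite !mulr0.
  have -> : flip E v = fun i => - flip (S :\: E) v i.
    apply: funext => i; rewrite /flip !inE.
    case: (boolP (i \in S)) => [_|/vS->]; last by rewrite !mulr0 oppr0.
    by case: (i \in E); rewrite /= ?mulN1r ?opprK ?mul1r.
  by rewrite lformN !exprM sqrrN.
rewrite /signsum (eq_bigr _ (fun E _ => repE E)).
have -> : (2 ^ #|S|.-1 = #|powerset (S :\ x)| * 1)%N.
  by rewrite muln1 card_powerset (cardsD1 x S) xS.
pose F E := lform (flip E v) ^+ (2 * s).
apply: (@waring_fibers K n _ d_gt0 _ _ _ _ F) => // E.
  rewrite powersetE subsetD1 /rep; case: ifP => xE; rewrite !inE xE ?andbF //=.
    by rewrite subsetDl.
  by rewrite subsetIl.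
by move=> _; apply/waringX/lform_homog.
Qed.

(** The vector [a \o p] is determined by the positions to which [p] sends the
first [k] indices, that is by an injection of ['I_k] into ['I_n]. *)
Lemma waring_orbsum a k :
    (0 < k <= n)%N -> (forall i : 'I_n, (k <= i)%N -> a i = 0) ->
  waring_decomposable (2 * s) (orbsum a) (2 ^ k.-1 * (k`! * 'C(n, k))).
Proof.
move=> /andP[k0 kn] ak.
pose kappa (p : 'S_n) := [ffun j : 'I_k => (p^-1)%g (widen_ord kn j)].
(* The sum has at most one term; it reads off the preimage of i, if any. *)
pose b (u : {ffun 'I_k -> 'I_n}) i := \sum_(j | u j == i) a (widen_ord kn j).
have bE (p : 'S_n) : a \o p = b (kappa p).
  apply: funext => i /=; rewrite /b /kappa.
  under eq_bigl => j do rewrite ffunE (canF_eq (permKV p)).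
  case: (ltnP (p i) k) => pik; last first.
    rewrite ak // big1 // => j /eqP e.
    by move: pik; rewrite -e leqNgt /= ltn_ord.
  rewrite (big_pred1 (Ordinal pik)) => [|j].
    by congr a; apply: val_inj.
  by rewrite -val_eqE.
rewrite /orbsum (eq_bigr _ (fun p _ => congr1 signsum (bE p))).
have -> : (2 ^ k.-1 * (k`! * 'C(n, k)) =
    #|[set u : {ffun 'I_k -> 'I_n} | injectiveb u]| * 2 ^ k.-1)%N.
  by rewrite card_inj_ffuns !card_ord mulnC [(k`! * _)%N]mulnC bin_ffact.
pose F u := signsum (b u).
apply: (@waring_fibers K n _ d_gt0 _ _ _ _ F) => // [p|u].
  rewrite inE; apply/injectiveP => i j; rewrite !ffunE => /perm_inj.
  by move/(congr1 val) => /= /val_inj.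
rewrite inE => /injectiveP inju.
have cu : #|[set u j | j in 'I_k]| = k by rewrite card_imset // card_ord.
rewrite -[X in (2 ^ X.-1)%N]cu; apply: waring_signsum; first by rewrite cu.
move=> i /imsetP iu; rewrite /b big_pred0 // => j.
by apply/negP => /eqP e; apply: iu; exists j.
Qed.

(** When the entries of the vector are equal, only the set of their positions
matters, which saves the factor [k`!]. *)
Lemma waring_orbsum_ones k : (0 < k <= n)%N ->
  waring_decomposable (2 * s) (orbsum (fun i => (i < k)%N%:R))
    (2 ^ k.-1 * 'C(n, k)).
Proof.
move=> /andP[k0 kn]; pose b (S : {set 'I_n}) i : K := (i \in S)%:R.
have bE (p : 'S_n) :
    (fun i : 'I_n => (i < k)%N%:R) \o p = b [set i | p i < k]%N.
  by apply: funext => i /=; rewrite /b inE.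
rewrite /orbsum (eq_bigr _ (fun p _ => congr1 signsum (bE p))).
have -> : (2 ^ k.-1 * 'C(n, k) =
    #|[set S : {set 'I_n} | #|S| == k]| * 2 ^ k.-1)%N.
  by rewrite card_draws card_ord mulnC.
pose F S := signsum (b S).
apply: (@waring_fibers K n _ d_gt0 _ _ _ _ F) => // [p|S].
  rewrite inE -[X in _ == X](card_ord_lt kn).
  rewrite -(card_imset [set i | p i < k]%N (@perm_inj _ p)).
  apply/eqP/eq_card => i; apply/imsetP/idP => [[j]|].
    by rewrite !inE => pj ->.
  by rewrite inE => ik; exists ((p^-1)%g i); rewrite ?inE permKV.
rewrite inE => /eqP cS; rewrite -[X in (2 ^ X.-1)%N]cS.
apply: waring_signsum; rewrite ?cS //.
by move=> i /negPf; rewrite /b => ->.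
Qed.

(** The factor of a coefficient of [orbsum a] that does not depend on [a]; its
second part records the cancellation of odd exponents by the sign changes. *)
Definition orbsum_weight m : K :=
  (lform (fun=> 1) ^+ (2 * s))@_m * \prod_i (1 + (-1) ^+ m i).

Lemma mcoeff_signsum v m :
  (signsum v)@_m = orbsum_weight m * \prod_i v i ^+ m i.
Proof.
rewrite raddf_sum /orbsum_weight /= -mulrA -big_split /=.
under [in RHS]eq_bigr do rewrite mulrDl mul1r addrC.
rewrite bigA_distr mulr_sumr; apply: eq_bigr => E _.
rewrite mcoeff_lformX; congr (_ * _); apply: eq_bigr => i _.
by rewrite /flip; case: (i \in E); rewrite ?mul1r // exprMn.
Qed.

Lemma mcoeff_orbsum a m :
  (orbsum a)@_m = orbsum_weight m * \sum_(p : 'S_n) \prod_i a (p i) ^+ m i.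
Proof.
rewrite raddf_sum mulr_sumr; apply: eq_bigr => p _.
by rewrite [LHS]mcoeff_signsum.
Qed.

End OrbitSums.

(** * Symmetric polynomials in the squares of the variables *)

Section EvenSymmetric.
Variables (K : numClosedFieldType) (n s : nat).
Implicit Types (a : 'I_n -> K) (m : 'X_{1..n}) (k : nat) (f g : {mpoly K[n]}).

Definition even_symmetric k f : Prop :=
  [/\ f \is symmetric, f \is (2 * s).-homog,
      forall m i, f@_m != 0 -> ~~ odd (m i)
    & forall m, f@_m != 0 -> (#|[set i | m i != 0%N]| <= k)%N].

Lemma even_symmetricD k c f g :
    even_symmetric k f -> even_symmetric k g ->
  even_symmetric k (f + c *: g).
Proof.
move=> [fs fh fe fk] [gs gh ge gk].
have fg m : (f + c *: g)@_m != 0 -> (f@_m != 0) || (g@_m != 0).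
  rewrite mcoeffD mcoeffZ -negb_and; apply: contra => /andP[/eqP-> /eqP->].
  by rewrite mulr0 addr0.
split; [exact/rpredD/rpredZ|exact/rpredD/rpredZ| |].
  by move=> m i /fg /orP[/fe|/ge].
by move=> m /fg /orP[/fk|/gk].
Qed.

Lemma even_symmetric_orbsum k a :
    (k <= n)%N -> (forall i : 'I_n, (k <= i)%N -> a i = 0) ->
  even_symmetric k (orbsum s a).
Proof.
move=> kn ak; split.
- apply/issymP => p; apply/mpolyP => m; rewrite mcoeff_sym !mcoeff_orbsum.
  rewrite /orbsum_weight (msym_coeff _ _ (rpredX _ (lform1_sym K n))).
  congr (_ * _ * _).
    rewrite [RHS](reindex_inj (@perm_inj _ p)); apply: eq_bigr => i _.
    by rewrite mnmE.
  rewrite (reindex_inj (mulgI p)); apply: eq_bigr => q _ /=.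
  rewrite [RHS](reindex_inj (@perm_inj _ p)); apply: eq_bigr => i _.
  by rewrite permM mnmE.
- apply: rpred_sum => p _; apply: rpred_sum => E _.
  by have := dhomogMn (2 * s) (lform_homog (flip E (a \o p))); rewrite mul1n.
- move=> m i; rewrite mcoeff_orbsum /orbsum_weight; apply: contra => mi.
  by rewrite (bigD1 i) //= -signr_odd mi expr1 subrr mul0r mulr0 mul0r.
move=> m; rewrite mcoeff_orbsum mulf_eq0 negb_or => /andP[_].
case: (boolP [exists p : 'S_n, \prod_i a (p i) ^+ m i != 0]); last first.
  rewrite negb_exists => /forallP p0 /negP[]; apply/eqP/big1 => p _.
  by apply/eqP; move: (p0 p); rewrite negbK.
move=> /existsP[p /prodf_neq0 pm] _.
rewrite -[X in (_ <= X)%N](card_ord_lt kn) -(card_imset _ (@perm_inj _ p)).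
apply/subset_leq_card/subsetP => j; case/imsetP => i; rewrite !inE => mi ->.
rewrite ltnNge; apply/negP => /ak api; move: (pm i isT).
by rewrite api expr0n (negPf mi) eqxx.
Qed.

(** The entries of [l] beyond its length default to [0], so the variables from
[k] on do not occur. *)
Definition part_mnm k (l : k.-tuple 'I_s.+1) : 'X_{1..n} :=
  [multinom (2 * nth 0 (map val l) i)%N | i < n].

Lemma mdeg_part_mnm k (l : k.-tuple 'I_s.+1) : (k <= n)%N ->
  mdeg (part_mnm l) = (2 * \sum_i tnth l i)%N.
Proof.
move=> kn; rewrite mdegE big_distrr /=.
have -> : (\sum_(i < k) 2 * tnth l i = \sum_(i < k) 2 * nth 0 (map val l) i)%N.
  apply: eq_bigr => i _.
  by rewrite -(tnth_nth _ (map_tuple val l)) tnth_map.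
rewrite (big_ord_widen _ (fun i => 2 * nth 0 (map val l) i)%N kn).
rewrite [RHS]big_mkcond; apply: eq_bigr => i _; rewrite mnmE.
by case: ltnP => // ki; rewrite nth_default // size_map size_tuple.
Qed.

Lemma mdeg_partition k (l : k.-tuple 'I_s.+1) : (k <= n)%N ->
  l \in partitions k s -> mdeg (part_mnm l) = (2 * s)%N.
Proof. by move=> kn; rewrite inE mdeg_part_mnm // => /and3P[_ _ /eqP->]. Qed.

Lemma part_mnm_antitone k (l : k.-tuple 'I_s.+1) (i j : 'I_n) :
  l \in partitions k s -> (i <= j)%N -> (part_mnm l j <= part_mnm l i)%N.
Proof.
rewrite inE => /and3P[ls _ _] ij.
by rewrite !mnmE leq_mul2l (sorted_antitone ls ij).
Qed.

Lemma part_mnm_inj k (l l' : k.-tuple 'I_s.+1) : (k <= n)%N ->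
  part_mnm l =1 part_mnm l' -> l = l'.
Proof.
move=> kn e; apply: eq_from_tnth => i; apply: val_inj.
have /eqP := e (widen_ord kn i); rewrite !mnmE eqn_mul2l /= => /eqP.
by rewrite -!(tnth_nth _ (map_tuple val _)) !tnth_map.
Qed.

Lemma even_antitone_part_mnm k m : (k <= n)%N ->
    (forall i j : 'I_n, (i <= j)%N -> (m j <= m i)%N) ->
    (forall i, ~~ odd (m i)) -> mdeg m = (2 * s)%N ->
    #|[set i | m i != 0%N]| = k ->
  exists2 l, l \in partitions k s & m = part_mnm l.
Proof.
move=> kn m_anti m_even mdeg_m mk.
have msupp i : (m i != 0%N) = (i < k)%N by rewrite (antitone_support m_anti) mk.
have m2 i : m i = (2 * (m i)./2)%N by rewrite mul2n even_halfK.
have mle i : ((m i)./2 < s.+1)%N.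
  rewrite ltnS -(leq_pmul2l (isT : (0 < 2)%N)) -m2 -mdeg_m mdegE.
  by rewrite (bigD1 i) //= leq_addr.
pose l := [tuple inord (m (widen_ord kn i))./2 : 'I_s.+1 | i < k].
have lE (i : 'I_k) : tnth l i = (m (widen_ord kn i))./2 :> nat.
  by rewrite tnth_mktuple inordK.
have lnth (i : 'I_k) : nth 0%N (map val l) i = (m (widen_ord kn i))./2.
  by rewrite -(tnth_nth _ (map_tuple val l)) tnth_map /= lE.
have ml : m = part_mnm l.
  apply/mnmP => i; rewrite mnmE; case: (ltnP i k) => ik.
    rewrite (lnth (Ordinal ik)) {1}m2; congr (2 * (m _)./2)%N.
    exact: val_inj.
  rewrite nth_default ?muln0; last by rewrite size_map size_tuple.
  apply/eqP.
  by rewrite -[_ == _]negbK msupp -leqNgt.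
exists l => //; rewrite inE; apply/and3P; split.
- apply/(sortedP 0%N) => i; rewrite size_map size_tuple => i1.
  rewrite (lnth (Ordinal i1)) (lnth (Ordinal (ltnW i1))).
  by apply/half_leq/m_anti => /=.
- apply/forallP => i; rewrite lE -(ltn_pmul2l (isT : (0 < 2)%N)) -m2 lt0n.
  by rewrite msupp /= ltn_ord.
by rewrite -(eqn_pmul2l (isT : (0 < 2)%N)) -mdeg_part_mnm // -ml mdeg_m.
Qed.

(** Permuting variables does not change the coefficients, so it is enough to
look at monomials with nonincreasing exponents; those in exactly [k] variables
come from partitions of [s] into [k] parts. *)
Lemma even_symmetric_support_pred k f : (k <= n)%N -> even_symmetric k f ->
    (forall l, l \in partitions k s -> f@_(part_mnm l) = 0) ->
  even_symmetric k.-1 f.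
Proof.
move=> kn [fs fh fe fk] f0; split=> // m fm.
have := fk m fm; rewrite leq_eqVlt => /predU1P[mk|]; last by case: k {kn fk f0}.
have /tuple_permP[p pE] : perm_eq (sort_tuple geq m) m by rewrite perm_sort.
pose mp : 'X_{1..n} := [multinom m (p i) | i < n].
have fmp : f@_mp != 0 by rewrite msym_coeff.
have mpk : #|[set i | mp i != 0%N]| = k.
  rewrite -mk -[RHS](card_imset _ (@perm_inj _ p^-1)); apply: eq_card => i.
  rewrite inE mnmE; apply/idP/imsetP => [mi|[j]].
    by exists (p i); rewrite ?inE ?permK.
  by rewrite inE => mj ->; rewrite permKV.
have mpE : sort geq m = [tuple mp i | i < n].
  rewrite -[LHS]/(tval (sort_tuple geq m)) pE; congr tval.
  by apply: eq_from_tnth => i; rewrite !tnth_mktuple mnmE mnm_tnth.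
have mp_anti (i j : 'I_n) : (i <= j)%N -> (mp j <= mp i)%N.
  have geq_total : total geq by move=> x y; rewrite /= leq_total.
  have := sort_sorted geq_total m; rewrite mpE => srt ij.
  have geq_trans : transitive geq by move=> y x z xy yz; exact: leq_trans yz xy.
  have geq_refl : reflexive geq by move=> x; exact: leqnn.
  have := sorted_leq_nth geq_trans geq_refl 0%N srt.
  move=> /(_ i j); rewrite !inE !size_tuple => /(_ (ltn_ord _) (ltn_ord _) ij).
  by rewrite -!(tnth_nth _ [tuple mp i | i < n]) !tnth_mktuple.
have [l lk mpl] : exists2 l, l \in partitions k s & mp = part_mnm l.
  apply: even_antitone_part_mnm => //; first by move=> i; apply: fe fmp.
  by apply: (dhomog_mf fh); rewrite mcoeff_msupp.
by move: fmp; rewrite mpl f0 ?eqxx.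
Qed.

End EvenSymmetric.

(** * Lowering the support by orbit sums *)

Section Reduction.
Variables (K : numClosedFieldType) (n s : nat).
Hypothesis s_gt0 : (0 < s)%N.
Implicit Types (a : 'I_n -> K) (m : 'X_{1..n}) (k : nat) (f g : {mpoly K[n]}).

Local Notation part_mnm := (@part_mnm n s _).
Local Notation orbsum_weight := (orbsum_weight K s).
Local Notation wdec := (@waring_decomposable K n (2 * s)).

Lemma orbsum_weight_neq0 k (l : k.-tuple 'I_s.+1) :
  (k <= n)%N -> l \in partitions k s -> orbsum_weight (part_mnm l) != 0.
Proof.
move=> kn lk; rewrite mulf_neq0 //.
  by rewrite -(mdeg_partition kn lk) gt_eqF // mcoeff_lform1X_gt0.
apply/prodf_neq0 => i _; rewrite mnmE exprM sqrrN !expr1n.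
by rewrite (pnatr_eq0 _ 2).
Qed.

Lemma even_symmetric_sub_orbsums k r (a : 'I_r -> 'I_n -> K) (c : 'I_r -> K) f :
    (k <= n)%N -> (forall j (i : 'I_n), (k <= i)%N -> a j i = 0) ->
    even_symmetric s k f ->
    (forall l, l \in partitions k s ->
       f@_(part_mnm l) = \sum_j c j * (orbsum s (a j))@_(part_mnm l)) ->
  even_symmetric s k.-1 (f - \sum_j c j *: orbsum s (a j)).
Proof.
move=> kn ak fk fE; apply: even_symmetric_support_pred => //.
  rewrite -sumrN; apply: (big_rec (fun g => even_symmetric s k (f + g))).
    by rewrite addr0.
  move=> j g _ IH; rewrite -scaleNr [_ + g]addrC addrA.
  by apply/even_symmetricD/even_symmetric_orbsum => //; exact: ak.
move=> l lk; rewrite mcoeffB fE // raddf_sum.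
by under [X in _ - X]eq_bigr do rewrite /= mcoeffZ; rewrite subrr.
Qed.

(** A point of the curve of the Kronecker substitution. The base [2 * s + 1]
exceeds every exponent of a form of degree [2 * s], so distinct monomials take
distinct powers of [t] as values. *)
Definition kronecker_point k (t : nat) (i : 'I_n) : K :=
  if (i < k)%N then t%:R ^+ ((2 * s).+1 ^ i) else 0.

Definition kronecker_exp m (p : 'S_n) := (\sum_i m i * (2 * s).+1 ^ p i)%N.

(** The values of all monomials in the orbit of [m] along the curve, as a
polynomial in the parameter. The filter discards the permutations that move
the support of [m] to indices where the points vanish. *)
Definition kronecker_poly k m : {poly K} :=
  \sum_(p : 'S_n | [forall i, (m i != 0%N) ==> (p i < k)%N])
    'X^(kronecker_exp m p).

Lemma horner_kronecker_poly k m t :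
  (kronecker_poly k m).[t%:R] =
  \sum_(p : 'S_n) \prod_i kronecker_point k t (p i) ^+ m i.
Proof.
rewrite horner_sum big_mkcond; apply: eq_bigr => p _.
case: ifPn => [/forallP mp|]; last first.
  rewrite negb_forall; case/existsP => i.
  rewrite negb_imply => /andP[mi /negPf pi].
  by rewrite (bigD1 i) //= /kronecker_point pi expr0n (negPf mi) mul0r.
rewrite hornerXn /kronecker_exp expr_sum; apply: eq_bigr => i _.
have [->|mi] := eqVneq (m i) 0%N; first by rewrite mul0n !expr0.
by rewrite /kronecker_point (implyP (mp i) mi) mulnC exprM.
Qed.

Lemma size_kronecker_poly k m : mdeg m = (2 * s)%N ->
  (size (kronecker_poly k m) <= (2 * s * (2 * s).+1 ^ n).+1)%N.
Proof.
move=> ms; apply: (leq_trans (size_sum _ _ _)); apply/bigmax_leqP => p _.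
rewrite size_polyXn ltnS -[X in (_ <= X * _)%N]ms mdegE big_distrl.
apply: leq_sum => i _ /=.
by rewrite leq_mul //; apply: leq_pexp2l => //; exact: ltnW.
Qed.

(** Reading the exponent in base [2 * s + 1] recovers the permuted monomial, and
two nonincreasing sequences that differ by a permutation are equal. These
exponents therefore separate the polynomials attached to different
partitions. *)
Lemma coef_kronecker_poly k (l l' : k.-tuple 'I_s.+1) : (k <= n)%N ->
    l \in partitions k s -> l' \in partitions k s ->
  ((kronecker_poly k (part_mnm l))`_(kronecker_exp (part_mnm l') 1) != 0)
  = (l == l').
Proof.
move=> kn lk l'k; rewrite coef_sum.
have [<-|ll'] := eqVneq l l'.
  rewrite -[LHS]/(_ != 0) psumr_neq0; last by move=> p _; rewrite coefXn ler0n.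
  apply/hasP; exists 1%g; first exact: mem_index_enum.
  rewrite coefXn eqxx ltr01 andbT; apply/forallP => i; apply/implyP.
  rewrite perm1 mnmE muln_eq0 /=; apply: contraR.
  by rewrite -leqNgt => ki; rewrite nth_default // size_map size_tuple.
apply/negbTE; rewrite negbK big1 // => p _; rewrite coefXn; apply/eqP.
rewrite pnatr_eq0 eqb0; apply: contra ll' => /eqP e; apply/eqP.
apply: (part_mnm_inj kn).
have part_mnm_lt (u : k.-tuple 'I_s.+1) i : u \in partitions k s ->
    (part_mnm u i < (2 * s).+1)%N.
  move=> uk; rewrite ltnS -(mdeg_partition kn uk) mdegE.
  by rewrite (bigD1 i) //= leq_addr.
have /digits_inj pE : (\sum_i (part_mnm l' i) * (2 * s).+1 ^ i =
                \sum_i (part_mnm l (p^-1 i)%g) * (2 * s).+1 ^ i)%N.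
  transitivity (kronecker_exp (part_mnm l') 1).
    by apply: eq_bigr => i _; rewrite perm1.
  rewrite e /kronecker_exp (reindex_inj (@perm_inj _ p^-1)) /=.
  by apply: eq_bigr => i _; rewrite permKV.
apply: (antitone_perm_eq (p := p)).
- by move=> i j; exact: part_mnm_antitone.
- by move=> i j; exact: part_mnm_antitone.
move=> i; rewrite pE ?permK // => j; exact: part_mnm_lt.
Qed.

(** The coefficients of the orbit sums at enough points of the curve form a
matrix with one column per partition. A linear relation between its columns
would be a polynomial in the parameter with more roots than its degree, so the
columns are independent, and some square set of rows is invertible. *)
Lemma generic_points k : (k <= n)%N ->
  exists a : 'I_(npartitions k s) -> 'I_n -> K,
    (forall j (i : 'I_n), (k <= i)%N -> a j i = 0) /\
    forall b : k.-tuple 'I_s.+1 -> K, exists c : 'I_(npartitions k s) -> K,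
      forall l, l \in partitions k s ->
        b l = \sum_j c j * (orbsum s (a j))@_(part_mnm l).
Proof.
move=> kn; rewrite -card_partitions.
(* One more than the largest degree that can occur along the curve. *)
set P := partitions k s; set N := (2 * s * (2 * s).+1 ^ n).+1.
pose la (j : 'I_#|P|) := enum_val j.
pose ml j := part_mnm (la j).
have laP j : la j \in P by exact: enum_valP.
pose W : 'M[K]_(N, #|P|) :=
  \matrix_(t, j) (orbsum s (kronecker_point k t))@_(ml j).
have WE t j :
    W t j = orbsum_weight (ml j) * (kronecker_poly k (ml j)).[t%:R].
  by rewrite mxE mcoeff_orbsum horner_kronecker_poly.
have Wfull : row_full W.
  rewrite /row_full -mxrank_tr -/(row_free _); apply: inj_row_free => u uW.
  pose q :=
    \sum_j (u 0 j * orbsum_weight (ml j)) *: kronecker_poly k (ml j).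
  have q0 : q = 0.
    apply: (@roots_geq_poly_eq0 _ _ [seq t%:R | t <- iota 0 N]).
    - apply/allP => x /mapP[t]; rewrite mem_iota => /andP[_ tN] {x}->.
      have /rowP/(_ (Ordinal tN)) := uW; rewrite !mxE => e.
      apply/eqP; rewrite horner_sum -[RHS]e; apply: eq_bigr => j _.
      by rewrite hornerZ -mulrA -(WE (Ordinal tN)) !mxE.
    - rewrite map_inj_uniq ?iota_uniq // => x y /eqP.
      by rewrite eqr_nat => /eqP.
    rewrite size_map size_iota; apply: (leq_trans (size_sum _ _ _)).
    apply/bigmax_leqP => j _; apply: (leq_trans (size_scale_leq _ _)).
    exact/size_kronecker_poly/mdeg_partition.
  apply/rowP => j; rewrite mxE; apply/eqP.
  (* At this exponent only the partition of index j contributes. *)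
  have /polyP/(_ (kronecker_exp (ml j) 1)) := q0.
  rewrite coef0 coef_sum (bigD1 j) //= [X in _ + X]big1 => [|i ij]; last first.
    have := coef_kronecker_poly kn (laP i) (laP j); rewrite coefZ.
    rewrite (inj_eq enum_val_inj) (negPf ij) => /negbFE /eqP ->.
    by rewrite mulr0.
  rewrite addr0 coefZ => /eqP; rewrite mulf_eq0.
  have := coef_kronecker_poly kn (laP j) (laP j); rewrite eqxx => /negPf->.
  by rewrite orbF mulf_eq0 (negPf (orbsum_weight_neq0 kn (laP j))) orbF.
exists (fun j => kronecker_point k (fullrankfun Wfull j)); split.
  by move=> j i ki; rewrite /kronecker_point ltnNge ki.
move=> b; pose V := rowsub (fullrankfun Wfull) W.
have Vu : V \in unitmx by exact: fullrowsub_unit.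
pose c := (\row_j b (la j)) *m invmx V.
exists (c 0) => l lP.
have := mulmxKV Vu (\row_j b (la j)); rewrite -/c => /rowP.
move=> /(_ (enum_rank_in lP l)); rewrite !mxE /ml /la enum_rankK_in // => <-.
by apply: eq_bigr => j _; rewrite !mxE /ml /la enum_rankK_in.
Qed.

(** No monomial has more than [n] variables. *)
Lemma even_symmetric_support_gt k f :
  (n < k)%N -> even_symmetric s k f -> even_symmetric s k.-1 f.
Proof.
move=> nk [? ? ? _]; split=> // m _; apply: (leq_trans (max_card _)).
by rewrite card_ord; case: k nk.
Qed.

Lemma even_symmetric_reduce k f : (0 < k)%N -> even_symmetric s k f ->
  exists2 g, even_symmetric s k.-1 g &
    wdec (f - g) (2 ^ k.-1 * k`! * npartitions k s * 'C(n, k)).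
Proof.
move=> k0 fk; case: (ltnP n k) => [nk|kn].
  exists f; first exact: even_symmetric_support_gt.
  by rewrite subrr; apply: waring0; rewrite muln_gt0.
have [a [a0 aP]] := generic_points kn.
have [c cE] := aP (fun l => f@_(part_mnm l)).
exists (f - \sum_j c j *: orbsum s (a j)).
  exact: even_symmetric_sub_orbsums.
rewrite opprB addrC subrK.
have -> : (2 ^ k.-1 * k`! * npartitions k s * 'C(n, k) =
    #|'I_(npartitions k s)| * (2 ^ k.-1 * (k`! * 'C(n, k))))%N.
  by rewrite card_ord; ring.
apply: waring_sum => [|j _]; first by rewrite muln_gt0.
apply/waringZ; rewrite ?muln_gt0 //.
by apply: waring_orbsum => //; rewrite ?k0 //; exact: a0.
Qed.

Lemma even_symmetric_reduce_near_top k f :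
    (0 < k)%N -> (s <= k.+1)%N -> even_symmetric s k f ->
  exists2 g, even_symmetric s k.-1 g & wdec (f - g) (2 ^ k.-1 * 'C(n, k)).
Proof.
move=> k0 sk fk; case: (ltnP n k) => [nk|kn].
  exists f; first exact: even_symmetric_support_gt.
  by rewrite subrr; apply: waring0; rewrite muln_gt0.
pose a (i : 'I_n) : K := (i < k)%N%:R.
have a0 (i : 'I_n) : (k <= i)%N -> a i = 0 by rewrite /a ltnNge => ->.
have aP l : l \in partitions k s -> (orbsum s a)@_(part_mnm l) != 0.
  move=> lk; rewrite mcoeff_orbsum mulf_neq0 ?orbsum_weight_neq0 //.
  have aX0 (p : 'S_n) : 0 <= \prod_i a (p i) ^+ part_mnm l i.
    by apply: prodr_ge0 => i _; rewrite exprn_ge0 // ler0n.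
  (* All terms are nonnegative and the identity contributes 1. *)
  rewrite psumr_neq0 //; apply/hasP; exists 1%g; first exact: mem_index_enum.
  apply/andP; split=> //; rewrite lt0r aX0 andbT; apply/prodf_neq0 => i _.
  rewrite perm1 mnmE /a; case: ltnP => ki; first by rewrite expr1n oner_eq0.
  by rewrite nth_default ?muln0 ?expr0 ?oner_eq0 // size_map size_tuple.
(* There may be no partition at all; then any scalar will do. *)
pose c := if [pick l in partitions k s] is Some l then
  f@_(part_mnm l) / (orbsum s a)@_(part_mnm l) else 0.
exists (f - \sum_(j < 1) c *: orbsum s a).
  apply: (@even_symmetric_sub_orbsums _ _ (fun=> a) (fun=> c)) => // l lk.
  rewrite big_ord1 /c; case: pickP => [l' l'k|/(_ l)]; last by rewrite lk.
  by rewrite (partitions_near_top sk lk l'k) divfK // aP.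
rewrite opprB addrC subrK big_ord1; apply: waringZ; first by rewrite muln_gt0.
by apply: waring_orbsum_ones; rewrite ?k0.
Qed.

Lemma even_symmetric_support0 f : even_symmetric s 0 f -> f = 0.
Proof.
move=> [_ fh _ fk]; apply/mpolyP => m; rewrite mcoeff0.
apply: contraTeq s_gt0 => fm.
have := fk m fm; rewrite leqn0 cards_eq0 => /eqP m0.
have := dhomog_mf fh; move=> /(_ m); rewrite mcoeff_msupp => /(_ fm) /=.
rewrite mdegE big1 => [|i _]; first by lia.
by apply/eqP; have := in_set0 i; rewrite -m0 inE => /negbFE.
Qed.

Lemma waring_even_symmetric k f : even_symmetric s k f ->
  wdec f (\sum_(1 <= j < k.+1) 2 ^ j.-1 * j`! * npartitions j s * 'C(n, j)).
Proof.
elim: k f => [|k IHk] f fk.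
  by rewrite (even_symmetric_support0 fk); apply: waring0; rewrite muln_gt0.
have [g gk fg] := even_symmetric_reduce (ltn0Sn k) fk.
by rewrite big_nat_recr //= -[f](subrK g) addrC; apply: waringD (IHk g gk) fg.
Qed.

(** An even monomial of degree [2 * s] involves at most [s] variables, since
each of them takes up at least two units of the degree. *)
Lemma even_symmetric_quadricX : even_symmetric s s (quadric K n ^+ s).
Proof.
have qE m i : (quadric K n ^+ s)@_m != 0 -> ~~ odd (m i).
  elim: s m => [|d IHd] m.
    by rewrite expr0 mcoeff1; case: (eqVneq m) => [->|]; rewrite ?mnm0E ?eqxx.
  apply: contraR; rewrite negbK => mi.
  rewrite exprSr /quadric mulr_sumr raddf_sum.
  apply/eqP/big1 => j _ /=.
  rewrite expr2 mulrA !mcoeffMXi; case: eqP => // _; case: eqP => // /eqP mj.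
  apply/eqP; apply: contraTT mi => /IHd; rewrite !mnmBE !mnm1E.
  move: mj; rewrite mnmBE mnm1E eqxx.
  case: (j =P i) => [->|_ _]; last by rewrite !subn0.
  by case: (m i) => [|[|x]]; rewrite // !subSS !subn0 /= negbK.
have qh : quadric K n ^+ s \is (2 * s).-homog.
  apply: dhomogMn; apply: rpred_sum => i _.
  have := @dhomogMn n K mdeg 1 'X_i 2; rewrite mul1n; apply.
  by rewrite dhomogX /= mdeg1.
split=> //.
  apply: rpredX; apply/issymP => p; rewrite raddf_sum /=.
  rewrite [RHS](reindex_inj (@perm_inj _ p)) /=; apply: eq_bigr => i _.
  rewrite rmorphXn /= msymX; congr ('X_[_] ^+ _).
  apply/mnmP => j; rewrite mnmE !mnm1E.
  by rewrite -(inj_eq (@perm_inj _ p)) permKV.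
move=> m qm; have ms : mdeg m = (2 * s)%N.
  by apply: (dhomog_mf qh); rewrite mcoeff_msupp.
rewrite -(leq_pmul2l (isT : (0 < 2)%N)) -ms mdegE -sum1_card big_distrr /=.
rewrite big_mkcond; apply: leq_sum => i _; rewrite inE.
by have := qE m i qm; case: (m i) => [|[]].
Qed.

End Reduction.

(** * Powers of the quadric *)

Section PowersOfQuadrics.
Variables (K : numClosedFieldType) (n : nat).

Lemma waring_rank_quadric : (waring_rank (2 * 1) (quadric K n ^+ 1) <= n)%N.
Proof.
have s0 : (0 < 1)%N by [].
have q1 := even_symmetric_quadricX K n 1.
have [g g0 fg] := even_symmetric_reduce_near_top s0 s0 (leqnSn 1) q1.
apply: waring_rank_le; rewrite (even_symmetric_support0 s0 g0) subr0 in fg.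
by rewrite mul1n bin1 in fg.
Qed.

(** The levels [s] and [s - 1], with [s = t + 2], are cleared with all-ones
vectors, the levels below with generic points. *)
Lemma waring_rank_quadricX t : (waring_rank (2 * t.+2) (quadric K n ^+ t.+2) <=
  2 ^ t.+1 * 'C(n, t.+2) + 2 ^ t * 'C(n, t.+1) +
  \sum_(1 <= k < t.+1) 2 ^ k.-1 * k`! * npartitions k t.+2 * 'C(n, k))%N.
Proof.
have s0 : (0 < t.+2)%N by [].
have qs := even_symmetric_quadricX K n t.+2.
have [g gs qg] := even_symmetric_reduce_near_top s0 s0 (leqnSn _) qs.
have [h ht gh] := even_symmetric_reduce_near_top s0 (ltn0Sn t) (leqnn _) gs.
apply: waring_rank_le; rewrite -[quadric _ _ ^+ _](subrK g).
rewrite -[g in _ + g](subrK h) addrA.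
apply: waringD; first exact: waringD.
exact: waring_even_symmetric.
Qed.

End PowersOfQuadrics.

Unset Implicit Arguments.

From mathcomp Require Import classical_sets reals topology normedtype landau.
Import numFieldNormedType.Exports.
Local Open Scope classical_set_scope.
Local Open Scope ring_scope.

Theorem theorem1p3 (R : realType) :
  (forall n s : nat, (0 < n)%N -> (0 < s)%N ->
    (waring_rank (2 * s) (quadric R[i] n ^+ s))%:R <=
      2 ^ (s%:Z - 1) * 'C(n, s)%:R + 2 ^ (s%:Z - 2) * 'C(n, s.-1)%:R
      + \sum_(1 <= k < s.-1)
          2 ^ (k%:Z - 1) * k`!%:R * (npartitions k s)%:R * 'C(n, k)%:R :> R)
  /\
  (forall s : nat, (0 < s)%N ->
    (fun n : nat => (waring_rank (2 * s) (quadric R[i] n ^+ s))%:R : R)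
      =O_\oo (fun n : nat => n%:R ^+ s : R)).
Proof.
have pow2 (k : nat) : (0 < k)%N -> 2 ^ (k%:Z - 1) = (2 ^ k.-1)%:R :> R.
  by case: k => // k _; rewrite intS addrC addKr natrX.
have bound n s : (0 < n)%N -> (0 < s)%N ->
    (waring_rank (2 * s) (quadric R[i] n ^+ s))%:R <=
      2 ^ (s%:Z - 1) * 'C(n, s)%:R + 2 ^ (s%:Z - 2) * 'C(n, s.-1)%:R
      + \sum_(1 <= k < s.-1)
          2 ^ (k%:Z - 1) * k`!%:R * (npartitions k s)%:R * 'C(n, k)%:R :> R.
  move=> _; case: s => [|[|t]] // _.
    (* Here the second term of the bound is 1/2 and can be dropped. *)
    rewrite big_geq // addr0 subrr expr0z mul1r bin1 -[leLHS]addr0.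
    by rewrite lerD ?ler_nat ?waring_rank_quadric // mulr_ge0 // exprz_ge0.
  have -> : t.+2%:Z - 2 = t.+1%:Z - 1 by rewrite !intS; ring.
  rewrite !pow2 // big_nat; under eq_bigr => k /andP[k1 _] do rewrite pow2 //.
  rewrite -big_nat -!natrM; under eq_bigr do rewrite -!natrM.
  by rewrite -natr_sum -!natrD ler_nat waring_rank_quadricX.
split=> // s s0.
pose C : R := 2 ^ (s%:Z - 1) + 2 ^ (s%:Z - 2)
  + \sum_(1 <= k < s.-1) 2 ^ (k%:Z - 1) * k`!%:R * (npartitions k s)%:R.
have bin_le n k : (0 < n)%N -> (k <= s)%N -> 'C(n, k)%:R <= n%:R ^+ s :> R.
  move=> n0 ks; rewrite -natrX ler_nat (leq_trans _ (leq_pexp2l n0 ks)) //.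
  rewrite (leq_trans (leq_pmulr _ (fact_gt0 k))) // bin_ffact ffact_prod.
  rewrite -[k in (n ^ k)%N]card_ord -prod_nat_const.
  by apply: leq_prod => i _; exact: leq_subr.
(* Adding 1 makes the constant positive. *)
apply/eqO_exP; exists (1 + C).
  rewrite ltr_pwDl // addr_ge0 //; first by rewrite addr_ge0 // exprz_ge0.
  by apply: sumr_ge0 => k _; rewrite !mulr_ge0 // exprz_ge0.
near=> n.
have n0 : (0 < n)%N by near: n; exact: nbhs_infty_gt.
rewrite !ger0_norm ?exprn_ge0 //.
apply: (le_trans (bound n s n0 s0)).
rewrite mulrDl mul1r -[leLHS]add0r lerD ?exprn_ge0 //.
rewrite /C !mulrDl mulr_suml.
rewrite !lerD ?ler_wpM2l ?exprz_ge0 ?bin_le // ?leq_pred //.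
rewrite big_nat [leRHS]big_nat; apply: ler_sum => k /andP[_ ks].
rewrite ler_wpM2l ?bin_le //; first by rewrite !mulr_ge0 // exprz_ge0.
by rewrite ltnW // (leq_trans ks) // leq_pred.
Unshelve. all: by end_near.
Qed.
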